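(* Let $E\subset[n]$ and assume that $\mathrm{rank}_{\mathbb Q}(B_E)=r$. Then $\Gamma_E$ is a full-rank lattice in $\mathbb R^{r}$ containing $\mathbb Z^{r}$, and $$\Gamma_E/\mathbb Z^{r}\cong\mathrm{Sat}(B_E\mathbb Z^{r})/B_E\mathbb Z^{r}.$$ If $\mathfrak L_\beta^{\supset E}$ is nonempty and $\Lambda_0$ is one of its elements, then any $\lambda_0\in\Lambda_0$ induces a bijection $$\Gamma_E/\mathbb Z^{r}\xrightarrow{\ \sim\ }\mathfrak L_\beta^{\supset E},\qquad z+\mathbb Z^{r}\longmapsto\Lambda(\lambda_0+Bz)=\lambda_0+Bz+L.$$ Consequently, $$|\mathfrak L_\beta^{\supset E}|=[\mathrm{Sat}(B_E\mathbb Z^{r}):B_E\mathbb Z^{r}]<\infty$$ (when $\mathfrak L_\beta^{\supset E}$ is nonempty), and the subfamily $\mathfrak L_\beta^{E}$ is finite.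
   Context: $[n]=\{1,\dots,n\}$. $A\in\mathrm{Mat}_{d\times n}(\mathbb Z)$ has rank $d$, $\beta\in\mathbb C^d$, $L=\mathrm{Ker}_{\mathbb Z}(A)$, $r=n-d$. $B\in\mathrm{Mat}_{n\times r}(\mathbb Z)$ is a matrix whose columns form a $\mathbb Z$-basis of $L$; $B_E$ is the submatrix of rows indexed by $E\subset[n]$. An exponent lattice is a coset $\Lambda(\lambda)=\lambda+L$ with $\lambda\in\mathbb C^n$, $A\lambda=\beta$; $\mathfrak L_\beta$ is the set of all of them. For $\Lambda=\Lambda(\lambda)$, $E_\Lambda=\{j\in[n]\mid\lambda_j\in\mathbb Z\}$ (independent of $\lambda\in\Lambda$). $\mathfrak L_\beta^{\supset E}=\{\Lambda\in\mathfrak L_\beta\mid E\subset E_\Lambda\}$ and $\mathfrak L_\beta^{E}=\{\Lambda\in\mathfrak L_\beta\mid E_\Lambda=E\}$. $\Gamma_E=\{z\in\mathbb C^r\mid B_Ez\in\mathbb Z^E\}$. For a subgroup $N\subset\mathbb Z^E$, $\mathrm{Sat}(N)=(\mathbb QN)\cap\mathbb Z^E$. *)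

(* Defs.v *)
From HB Require Import structures.
From mathcomp Require Import all_boot all_order all_algebra.
From mathcomp Require Import ring_quotient.
From mathcomp Require Import all_classical all_reals.
From mathcomp Require Import complex.

Set Implicit Arguments.
Unset Strict Implicit.
Unset Printing Implicit Defensive.

Import Order.TTheory GRing.Theory Num.Theory.
Local Open Scope classical_set_scope.
Local Open Scope ring_scope.

Definition ofZ (K : pzRingType) (m p : nat) (M : 'M[int]_(m, p)) : 'M[K]_(m, p) :=
  map_mx (fun k : int => k%:~R) M.

Lemma ofZB (K : pzRingType) (m p : nat) (M N : 'M[int]_(m, p)) :
  ofZ K (M - N) = ofZ K M - ofZ K N.
Proof. by apply/matrixP => i j; rewrite !mxE mulrzBr. Qed.

Lemma ofZ0 (K : pzRingType) (m p : nat) : ofZ K (0 : 'M[int]_(m, p)) = 0.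
Proof. by apply/matrixP => i j; rewrite !mxE. Qed.

Section SubgroupQuotient.
Variables (V : zmodType) (S : zmodClosed V).

Record subgrp := Subgrp { subgrp_val : V; _ : subgrp_val \in S }.
HB.instance Definition _ := [isSub for subgrp_val].
HB.instance Definition _ := [Choice of subgrp by <:].
HB.instance Definition _ := [SubChoice_isSubZmodule of subgrp by <:].

Variable T : zmodClosed V.

Definition traceof : {pred subgrp} := fun x => val x \in T.

Fact traceof_zmod_closed : zmod_closed traceof.
Proof.
split=> [|x y xT yT]; first by rewrite unfold_in raddf0 rpred0.
by rewrite unfold_in raddfB rpredB.
Qed.

HB.instance Definition _ :=
  GRing.isZmodClosed.Build subgrp traceof traceof_zmod_closed.

(* The group S / T when T is contained in S (in general, S / (S :&: T)). *)
Definition quotgrp := {ideal_quot traceof}.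
HB.instance Definition _ := GRing.Zmodule.on quotgrp.

Definition cosetof (x : subgrp) : quotgrp := (\pi_({ideal_quot traceof}) x)%qT.

End SubgroupQuotient.

Section Lattices.
Variable R : realType.
Notation C := (complex R).

Definition int_vec (m : nat) : {pred 'cV[C]_m} :=
  fun z => `[< exists k : 'cV[int]_m, z = ofZ C k >].

Fact int_vec_zmod_closed (m : nat) : zmod_closed (@int_vec m).
Proof.
split=> [|x y /asboolP[k ->] /asboolP[l ->]]; apply/asboolP.
  by exists 0; rewrite ofZ0.
by exists (k - l); rewrite ofZB.
Qed.

HB.instance Definition _ (m : nat) :=
  GRing.isZmodClosed.Build 'cV[C]_m (@int_vec m) (@int_vec_zmod_closed m).

(* Full-rank lattices of R^m: Z-spans of R-bases (the columns of P). *)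
Definition full_rank_lattice (m : nat) (G : set 'cV[R]_m) : Prop :=
  exists2 P : 'M[R]_m, P \in unitmx &
    G = [set P *m ofZ R c | c in [set: 'cV[int]_m]].

Definition complexify (m : nat) (x : 'cV[R]_m) : 'cV[C]_m :=
  map_mx (real_complex R) x.

End Lattices.

Arguments int_vec R m : clear implicits.

Section IntegerSubgroups.
Variable m : nat.

Definition Qspan (N : set 'cV[int]_m) : set 'cV[rat]_m :=
  [set v | exists2 s : seq (rat * 'cV[int]_m),
    (forall p, p \in s -> N p.2) & v = \sum_(p <- s) p.1 *: ofZ rat p.2].

Definition Sat (N : set 'cV[int]_m) : {pred 'cV[int]_m} :=
  fun v => `[< Qspan N (ofZ rat v) >].

Fact Sat_zmod_closed (N : set 'cV[int]_m) : zmod_closed (Sat N).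
Proof.
split=> [|x y /asboolP[s sN xE] /asboolP[t tN yE]]; apply/asboolP.
  by exists [::] => //; rewrite big_nil ofZ0.
exists (s ++ [seq (- p.1, p.2) | p <- t]).
  by move=> p; rewrite mem_cat => /orP[/sN//|/mapP[q /tN qN ->]].
rewrite ofZB xE yE big_cat big_map/=; congr (_ + _).
by rewrite -sumrN; apply: eq_bigr => p _; rewrite scaleNr.
Qed.

HB.instance Definition _ (N : set 'cV[int]_m) :=
  GRing.isZmodClosed.Build 'cV[int]_m (Sat N) (Sat_zmod_closed N).

Definition Zimage (p : nat) (M : 'M[int]_(m, p)) : {pred 'cV[int]_m} :=
  fun v => `[< exists c : 'cV[int]_p, v = M *m c >].

Fact Zimage_zmod_closed (p : nat) (M : 'M[int]_(m, p)) : zmod_closed (Zimage M).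
Proof.
split=> [|x y /asboolP[k ->] /asboolP[l ->]]; apply/asboolP.
  by exists 0; rewrite mulmx0.
by exists (k - l); rewrite mulmxBr.
Qed.

HB.instance Definition _ (p : nat) (M : 'M[int]_(m, p)) :=
  GRing.isZmodClosed.Build 'cV[int]_m (Zimage M) (Zimage_zmod_closed M).

Lemma sub_Sat (N : set 'cV[int]_m) (v : 'cV[int]_m) : N v -> v \in Sat N.
Proof.
move=> Nv; apply/asboolP; exists [:: (1, v)]; last by rewrite big_seq1 scale1r.
by move=> p; rewrite inE => /eqP ->.
Qed.

End IntegerSubgroups.

Section ExponentLattices.
Variables (R : realType) (d n : nat) (A : 'M[int]_(d, n)).
Notation C := (complex R).

Definition KerZ : set 'cV[int]_n := [set l | A *m l = 0].

Definition is_Zbasis (r : nat) (N : set 'cV[int]_n) (B : 'M[int]_(n, r)) : Prop :=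
  (forall c : 'cV[int]_r, B *m c = 0 -> c = 0) /\
  N = [set B *m c | c in [set: 'cV[int]_r]].

Definition Lambda (lam : 'cV[C]_n) : set 'cV[C]_n :=
  [set lam + ofZ C l | l in KerZ].

Definition exp_lattices (beta : 'cV[C]_d) : set (set 'cV[C]_n) :=
  [set Lambda lam | lam in [set lam | ofZ C A *m lam = beta]].

Definition is_integer (x : C) : Prop := exists k : int, x = k%:~R.

(* The choice of a point of the coset is immaterial, see intset_Lambda. *)
Definition intset (La : set 'cV[C]_n) : {set 'I_n} :=
  [set j | `[< exists2 lam, La lam & is_integer (lam j 0) >]]%SET.

Lemma intset_Lambda (lam : 'cV[C]_n) (j : 'I_n) :
  (j \in intset (Lambda lam)) <-> is_integer (lam j 0).
Proof.
rewrite inE; split=> [/asboolP[_ [l _ <-] [k]]|lamZ]; last first.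
  apply/asboolP; exists lam => //; exists 0; first by rewrite /KerZ/= mulmx0.
  by rewrite ofZ0 addr0.
rewrite !mxE => kE; exists (k - l j 0).
by rewrite mulrzBr -kE addrK.
Qed.

Definition exp_lattices_sup (beta : 'cV[C]_d) (E : {set 'I_n}) :
    set (set 'cV[C]_n) :=
  [set La | exp_lattices beta La /\ E \subset intset La].

Definition exp_lattices_eq (beta : 'cV[C]_d) (E : {set 'I_n}) :
    set (set 'cV[C]_n) :=
  [set La | exp_lattices beta La /\ intset La = E].

End ExponentLattices.

Section Gamma.
Variables (R : realType) (n r : nat) (B : 'M[int]_(n, r)) (E : {set 'I_n}).
Notation C := (complex R).

(* Z^E is 'cV[int]_#|E|, coordinates being listed in the order of enum E. *)
Definition rows_in : 'M[int]_(#|E|, r) := rowsub (@enum_val _ (mem E)) B.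

Definition Gamma : {pred 'cV[C]_r} :=
  fun z => ofZ C rows_in *m z \in int_vec R #|E|.

Fact Gamma_zmod_closed : zmod_closed Gamma.
Proof.
split=> [|x y xG yG]; first by rewrite unfold_in mulmx0 rpred0.
by rewrite unfold_in mulmxBr rpredB.
Qed.

HB.instance Definition _ :=
  GRing.isZmodClosed.Build 'cV[C]_r Gamma Gamma_zmod_closed.

Definition GammaModZ := quotgrp Gamma (int_vec R r).
HB.instance Definition _ := GRing.Zmodule.on GammaModZ.

Definition SatMod :=
  quotgrp (Sat [set v | v \in Zimage rows_in]) (Zimage rows_in).
HB.instance Definition _ := GRing.Zmodule.on SatMod.

End Gamma.

Arguments Gamma R {n r} B E.
Arguments GammaModZ R {n r} B E.

(* Main.v *)
Require Import Defs.
From HB Require Import structures.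
From mathcomp Require Import all_boot all_order all_algebra.
From mathcomp Require Import ring_quotient.
From mathcomp Require Import all_classical all_reals.
From mathcomp Require Import complex.

Set Implicit Arguments.
Unset Strict Implicit.
Unset Printing Implicit Defensive.

Import Order.TTheory GRing.Theory Num.Theory.
Local Open Scope classical_set_scope.
Local Open Scope ring_scope.

(** Write M for the integer matrix of the rows of B indexed by E, which has full
    column rank.  Everything about Gamma and Sat follows from one factorization,
    read off the Smith normal form: M = N *m Q, where Q is a square integer
    matrix of nonzero determinant and N has an integer left inverse
    ([primitive_factorization]).  Because N is left invertible over the
    integers, M z is integral exactly when Q z is.  So Gamma is the image of the
    integer vectors under the inverse of Q, a lattice spanned by a real (indeed
    rational) basis, and the same computation over the rationals shows that the
    saturation of the image of M is the image of N ([factor_integral], [SatP]).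

    Multiplication by M therefore maps Gamma onto the saturation, and it pulls
    the image of M back to the integer vectors because M is injective; this
    gives the isomorphism of quotients ([GammaModZ_iso]).  The quotient of the
    saturation is also the quotient of the integer vectors by the image of Q,
    which contains every multiple of det Q, since Q times its adjugate is
    det Q; hence it is finite ([finite_Sat_quot]).

    As for exponent lattices, fix lam0 in one that is integral on E.  Any other
    solution of the linear system is lam0 + B z with z complex, because ranks
    do not change under extension of scalars, so the columns of B span the
    complex kernel of A ([kernelP]).  That solution is again integral on E
    exactly when B z is, that is when z lies in Gamma ([exp_lattices_supP]),
    and two values of z give the same coset exactly when they differ by an
    integer vector, B being injective and its columns spanning the integer
    kernel ([Lambda_bij]). *)

(** * Quotients of subgroups *)

Lemma cosetofP (V : zmodType) (S T : zmodClosed V) (x y : subgrp S) :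
  cosetof T x = cosetof T y <-> val x - val y \in T.
Proof.
have E : (val x - val y \in T) =
    (x == y %[mod {ideal_quot traceof (S := S) T}])%qT.
  by rewrite -Quotient.idealrBE [RHS]unfold_in.
by rewrite E; split => [/eqP|/eqP].
Qed.

Lemma cosetof_surj (V : zmodType) (S T : zmodClosed V) (q : quotgrp S T) :
  exists x : subgrp S, cosetof T x = q.
Proof. by exists (repr q); rewrite /cosetof reprK. Qed.

Lemma cosetofB (V : zmodType) (S T : zmodClosed V) (x y : subgrp S) :
  cosetof T (x - y) = cosetof T x - cosetof T y.
Proof. exact: (raddfB (\pi_({ideal_quot traceof (S := S) T}))%qT). Qed.

(** First isomorphism theorem for S / T and S' / T': the inverse image of T'
    under f is T, so f is well defined and injective on cosets. *)
Lemma quotgrp_iso (V V' : zmodType) (S T : zmodClosed V) (S' T' : zmodClosed V')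
    (f : subgrp S -> subgrp S') :
  {morph f : x y / x - y} ->
  (forall y, exists x, f x = y) ->
  (forall x, (val (f x) \in T') = (val x \in T)) ->
  exists g : {additive quotgrp S T -> quotgrp S' T'}, bijective g.
Proof.
move=> fB fsurj fT.
have fcoset x y : cosetof T x = cosetof T y <->
    cosetof T' (f x) = cosetof T' (f y).
  by rewrite !cosetofP -[val x - val y]/(val (x - y)) -fT fB.
pose g (q : quotgrp S T) : quotgrp S' T' := cosetof T' (f (repr q)).
have gE x : g (cosetof T x) = cosetof T' (f x).
  by apply/fcoset; rewrite /cosetof reprK.
have gB : zmod_morphism g.
  move=> p q.
  have [[x <-] [y <-]] := (cosetof_surj p, cosetof_surj q).
  by rewrite -cosetofB !gE fB cosetofB.
pose gadd := GRing.isZmodMorphism.Build _ _ g gB.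
pose G : {additive quotgrp S T -> quotgrp S' T'} := HB.pack g gadd.
exists G; rewrite -setTT_bijective; split => // [p q _ _|q _].
  have [[x <-] [y <-]] := (cosetof_surj p, cosetof_surj q).
  by rewrite /G/= !gE => /fcoset.
have [y <-] := cosetof_surj q; have [x <-] := fsurj y.
by exists (cosetof T x) => //; rewrite /G/= gE.
Qed.

(** * Change of scalars for integer matrices *)

Lemma ofZM (K : pzRingType) m n p (M : 'M[int]_(m, n)) (N : 'M[int]_(n, p)) :
  ofZ K (M *m N) = ofZ K M *m ofZ K N.
Proof. exact: (map_mxM (intmul (1 : K))). Qed.

Lemma ofZ1 (K : pzRingType) n : ofZ K (1%:M : 'M[int]_n) = 1%:M.
Proof. exact: (map_mx1 (intmul (1 : K))). Qed.

Lemma map_ofZ (K L : pzRingType) (f : {rmorphism K -> L}) m n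
  (M : 'M[int]_(m, n)) : map_mx f (ofZ K M) = ofZ L M.
Proof. by apply/matrixP => i j; rewrite !mxE rmorph_int. Qed.

Lemma ofZD (K : pzRingType) m n (M N : 'M[int]_(m, n)) :
  ofZ K (M + N) = ofZ K M + ofZ K N.
Proof. exact: (map_mxD (intmul (1 : K))). Qed.

Lemma ofZN (K : pzRingType) m n (M : 'M[int]_(m, n)) : ofZ K (- M) = - ofZ K M.
Proof. exact: (map_mxN (intmul (1 : K))). Qed.

Lemma ofZ_inj (K : numDomainType) m n : injective (@ofZ K m n).
Proof.
move=> M N /matrixP eMN; apply/matrixP => i j; move: (eMN i j).
by rewrite !mxE => /intr_inj.
Qed.

Lemma rank_ofZ (K : numFieldType) m n (M : 'M[int]_(m, n)) :
  \rank (ofZ K M) = \rank (ofZ rat M).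
Proof. by rewrite -(map_ofZ (ratr : {rmorphism rat -> K})) mxrank_map. Qed.

Lemma ofZ_mulmx_inj (K : numFieldType) m n (M : 'M[int]_(m, n)) :
  \rank (ofZ rat M) = n -> injective (mulmx (ofZ K M) : 'cV_n -> 'cV_m).
Proof. by move=> rkM; apply: row_full_inj; rewrite /row_full rank_ofZ rkM. Qed.

Lemma ofZ_unitmx (K : numFieldType) n (Q : 'M[int]_n) :
  \rank (ofZ rat Q) = n -> ofZ K Q \in unitmx.
Proof. by move=> rkQ; rewrite -row_free_unit /row_free rank_ofZ rkQ. Qed.

(** The transpose of B sits inside the kernel of the transpose of A, and the
    rank hypothesis says that the dimensions agree. *)
Lemma mulmx_ker (F : fieldType) d n r (A : 'M[F]_(d, n)) (B : 'M[F]_(n, r))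
    (z : 'cV[F]_n) :
  A *m B = 0 -> (n - \rank A <= \rank B)%N -> A *m z = 0 ->
  exists c : 'cV[F]_r, z = B *m c.
Proof.
move=> AB0 rkAB Az0.
have sBK : (B^T <= kermx A^T)%MS.
  by apply/sub_kermxP; rewrite -trmx_mul AB0 trmx0.
have sKB : (kermx A^T <= B^T)%MS.
  by rewrite -(geq_leqif (mxrank_leqif_sup sBK)) mxrank_ker !mxrank_tr.
have /submxP[c cE] : (z^T <= B^T)%MS.
  by apply: submx_trans sKB; apply/sub_kermxP; rewrite -trmx_mul Az0 trmx0.
by exists c^T; apply: trmx_inj; rewrite trmx_mul trmxK.
Qed.

(** * Integer matrices of full column rank *)

(** If M = L D U is a Smith normal form, the rectangular diagonal matrix D is
    J times a square diagonal matrix, where J stacks an identity over zeros.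
    Then N is L J, left invertible since L is invertible, and Q gathers the
    square factors; its rank is at least that of M, whose factor it is. *)
Lemma primitive_factorization m r (M : 'M[int]_(m, r)) :
  \rank (ofZ rat M) = r ->
  exists (N : 'M[int]_(m, r)) (N' : 'M[int]_(r, m)) (Q : 'M[int]_r),
    [/\ M = N *m Q, N' *m N = 1%:M & \rank (ofZ rat Q) = r].
Proof.
move=> rkM; have [L Lu [U Uu [s _ ME]]] := int_Smith_normal_form M.
have le_rm : (r <= m)%N by rewrite -rkM rank_leq_row.
pose J : 'M[int]_(m, r) := pid_mx r.
pose D : 'M[int]_r := diag_mx (\row_i s`_i).
have DE : \matrix_(i, j) (s`_i *+ (i == j :> nat)) = J *m D.
  apply/matrixP => i j; rewrite /J /D mul_mx_diag !mxE.
  have [eij|_] := eqVneq (i : nat) j; last by rewrite mulr0n mul0r.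
  by rewrite eij ltn_ord mul1r mulr1n.
have JJ : (pid_mx r : 'M[int]_(r, m)) *m J = 1%:M.
  by rewrite /J pid_mx_id // pid_mx_1.
exists (L *m J), (pid_mx r *m invmx L), (D *m U).
have MQ : M = L *m J *m (D *m U) by rewrite ME DE !mulmxA.
split=> //; first by rewrite mulmxA mulmxKV.
apply/eqP; rewrite eqn_leq rank_leq_row /=.
by rewrite -[leqLHS]rkM [in leqLHS]MQ ofZM mxrankM_maxr.
Qed.

Section Factorization.
Variables (m r : nat) (M N : 'M[int]_(m, r)) (N' : 'M[int]_(r, m)).
Variable (Q : 'M[int]_r).
Hypotheses (ME : M = N *m Q) (N'N : N' *m N = 1%:M).
Hypothesis (rkQ : \rank (ofZ rat Q) = r).

(** Cancelling N on the left shows that Q z is the integer vector N' k.  Taking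
    z complex describes Gamma, and taking z rational describes Sat. *)
Lemma factor_integral (K : numFieldType) (z : 'cV[K]_r) (k : 'cV[int]_m) :
  ofZ K M *m z = ofZ K k ->
  z = invmx (ofZ K Q) *m ofZ K (N' *m k) /\ k = N *m (N' *m k).
Proof.
move=> zk; have Qz : ofZ K Q *m z = ofZ K (N' *m k).
  by rewrite ofZM -zk ME ofZM !mulmxA -ofZM N'N ofZ1 mul1mx.
split; first by rewrite -Qz mulKmx// ofZ_unitmx.
by apply: (@ofZ_inj K); rewrite -zk ME !ofZM -mulmxA Qz ofZM.
Qed.

Lemma factor_integralV (K : numFieldType) (c : 'cV[int]_r) :
  ofZ K M *m (invmx (ofZ K Q) *m ofZ K c) = ofZ K (N *m c).
Proof. by rewrite ME !ofZM -mulmxA mulKVmx// ofZ_unitmx. Qed.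

(** A vector of the rational span of the image of M is M q with q rational, and
    [factor_integral] applies to it; conversely N c is the combination of the
    columns of M whose coefficients are the entries of Q^-1 c. *)
Lemma SatP (v : 'cV[int]_m) :
  v \in Sat [set v | v \in Zimage M] <-> exists c, v = N *m c.
Proof.
split=> [/asboolP[s sM vE]|[c ->]].
  suff [q qE] : exists q, ofZ rat M *m q = ofZ rat v.
    by have [_ ->] := factor_integral qE; exists (N' *m v).
  rewrite vE big_seq; elim/big_ind: _ => [|x y [p <-] [q <-]|p /sM].
  - by exists 0; rewrite mulmx0.
  - by exists (p + q); rewrite mulmxDr.
  - move=> /asboolP[c ->]; exists (p.1 *: ofZ rat c).
    by rewrite ofZM scalemxAr.
apply/asboolP; pose q := invmx (ofZ rat Q) *m ofZ rat c.
exists [seq (q i 0, col i M) | i : 'I_r].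
  move=> _ /mapP[i _ ->]; apply/asboolP; exists (delta_mx i 0).
  by rewrite colE.
rewrite -factor_integralV -/q big_image /=.
apply/colP => i; rewrite summxE mxE; apply: eq_bigr => j _.
by rewrite !mxE mulrC.
Qed.

(** Reducing the entries of c modulo det Q changes N c by a vector
    N (det Q) k = N Q (adj Q) k = M (adj Q) k, so the vectors N c with entries
    of c between 0 and |det Q| - 1 already represent all the classes. *)
Lemma finite_Sat_quot :
  finite_set [set: quotgrp (Sat [set v | v \in Zimage M]) (Zimage M)].
Proof.
pose D := `|\det Q|%N.
have D0 : (0 < D)%N.
  have := ofZ_unitmx rat rkQ.
  by rewrite unitmxE det_map_mx unitfE intr_eq0 absz_gt0.
pose S := Sat [set v | v \in Zimage M].
have NS c : N *m c \in S by apply/SatP; exists c.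
pose f (c : {ffun 'I_r -> 'I_D}) : quotgrp S (Zimage M) :=
  cosetof (Zimage M) (Subgrp (NS (\col_i (c i : nat)%:Z))).
suff -> : [set: quotgrp S (Zimage M)] = range f.
  exact/finite_image/finite_finset.
apply/seteqP; split=> // q _; have [v <-] := cosetof_surj q.
have /SatP[c cE] : val v \in S := valP v.
have D0Z : \det Q != 0 by rewrite -absz_gt0.
pose res (i : 'I_r) := `|modz (c i ord0) (\det Q)|%N.
have resE i : c i 0 = divz (c i 0) (\det Q) * \det Q + (res i)%:Z.
  by rewrite gez0_abs ?modz_ge0// -divz_eq.
have resD i : (res i < D)%N.
  by rewrite -ltz_nat gez0_abs ?modz_ge0// abszE ltz_mod.
exists [ffun i => Ordinal (resD i)] => //; apply/cosetofP.
apply/asboolP; exists (\adj Q *m - (\col_i divz (c i 0) (\det Q))).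
rewrite [in RHS]ME -mulmxA (mulmxA Q) mul_mx_adj cE -mulmxBr; congr (_ *m _).
apply/colP => i; rewrite mul_scalar_mx !mxE ffunE /= [X in _ - X]resE.
by rewrite opprD addrCA subrr addr0 mulrN mulrC.
Qed.

End Factorization.

(** * The lattice Gamma *)

Section GammaLattice.
Variables (R : realType) (n r : nat) (B : 'M[int]_(n, r)) (E : {set 'I_n}).
Hypothesis rankBE : \rank (ofZ rat (rows_in B E)) = r.
Notation C := (complex R).

Lemma Gamma_full_rank : exists2 G : set 'cV[R]_r, full_rank_lattice G &
  [set z : 'cV[C]_r | z \in Gamma R B E] = [set complexify x | x in G].
Proof.
have [N [N' [Q [ME N'N rkQ]]]] := primitive_factorization rankBE.
pose P := invmx (ofZ R Q).
have PE c : complexify (P *m ofZ R c) = invmx (ofZ C Q) *m ofZ C c.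
  by rewrite /complexify map_mxM map_invmx !map_ofZ.
exists [set P *m ofZ R c | c in [set: 'cV[int]_r]].
  by exists P => //; rewrite unitmx_inv ofZ_unitmx.
apply/seteqP; split=> [z /asboolP[k kE]|_ [_ [c _ <-] <-]] /=.
  have [-> _] := factor_integral ME N'N rkQ kE.
  by exists (P *m ofZ R (N' *m k)) => //; exists (N' *m k).
rewrite PE; apply/asboolP; exists (N *m c).
  by rewrite (factor_integralV ME).
Qed.

Lemma int_vec_Gamma (z : 'cV[C]_r) : z \in int_vec R r -> z \in Gamma R B E.
Proof.
move=> /asboolP[c ->]; apply/asboolP.
by exists (rows_in B E *m c); rewrite ofZM.
Qed.

(** The map is z |-> M z, with M = rows_in B E.  Gamma consists of the complex
    vectors Q^-1 c with c integral, which go to N c, that is onto Sat; and M is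
    injective, so M z lies in the image of M only if z is integral. *)
Lemma GammaModZ_iso :
  exists f : {additive GammaModZ R B E -> SatMod B E}, bijective f.
Proof.
have [N [N' [Q [ME N'N rkQ]]]] := primitive_factorization rankBE.
have zM (z : subgrp (Gamma R B E)) : exists k : 'cV[int]_#|E|,
    ofZ C (rows_in B E) *m val z = ofZ C k.
  exact/asboolP/(valP z).
have [f fE] := choice zM.
have fSat z : f z \in Sat [set v | v \in Zimage (rows_in B E)].
  apply/(SatP ME N'N rkQ).
  have [_ ->] := factor_integral ME N'N rkQ (fE z).
  by exists (N' *m f z).
apply: ((@quotgrp_iso _ _ _ _ _ _ (fun z => Subgrp (fSat z)))).
- move=> x y; apply: val_inj; apply: (@ofZ_inj C).
  rewrite -[RHS]/(ofZ C (f x - f y)) -[LHS]/(ofZ C (f (x - y))).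
  by rewrite ofZB -!fE -mulmxBr.
- move=> v; have /(SatP ME N'N rkQ)[c cE] := valP v.
  have zG : invmx (ofZ C Q) *m ofZ C c \in Gamma R B E.
    by apply/asboolP; exists (N *m c); rewrite (factor_integralV ME).
  exists (Subgrp zG); apply: val_inj; apply: (@ofZ_inj C).
  by rewrite /= -fE cE /= (factor_integralV ME).
- move=> z /=; apply/asboolP/asboolP => -[c cE]; exists c.
    by apply: (ofZ_mulmx_inj rankBE); rewrite [LHS]fE cE ofZM.
  by apply: (@ofZ_inj C); rewrite -fE /= cE ofZM.
Qed.

Lemma finite_SatMod : finite_set [set: SatMod B E].
Proof.
have [N [N' [Q [ME N'N rkQ]]]] := primitive_factorization rankBE.
exact: (finite_Sat_quot ME N'N rkQ).
Qed.

End GammaLattice.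

(** * Exponent lattices integral on E *)

Section ExponentLattices.
Variables (R : realType) (d n r : nat) (A : 'M[int]_(d, n)).
Variables (B : 'M[int]_(n, r)) (E : {set 'I_n}) (beta : 'cV[complex R]_d).
Hypothesis rankA : \rank (ofZ rat A) = d.
Hypothesis rE : r = (n - d)%N.
Hypothesis basisB : is_Zbasis (KerZ A) B.
Hypothesis rankBE : \rank (ofZ rat (rows_in B E)) = r.
Notation C := (complex R).

Lemma GammaP (z : 'cV[C]_r) :
  z \in Gamma R B E <-> forall j, j \in E -> is_integer ((ofZ C B *m z) j 0).
Proof.
have rowE i : (ofZ C (rows_in B E) *m z) i 0 = (ofZ C B *m z) (enum_val i) 0.
  by rewrite !mxE; apply: eq_bigr => j _; rewrite !mxE.
split=> [/asboolP[k kE] j jE|zE].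
  exists (k (enum_rank_in jE j) 0).
  by rewrite -[j in LHS](enum_rankK_in jE jE) -rowE kE mxE.
apply/asboolP; have [k kE] := choice (fun i => zE _ (enum_valP i)).
by exists (\col_i k i); apply/colP => i; rewrite rowE kE !mxE.
Qed.

Lemma rank_ofZ_basis : \rank (ofZ rat B) = r.
Proof.
apply/eqP; rewrite eqn_leq rank_leq_col /= -[leqLHS]rankBE.
by rewrite /rows_in rowsubE ofZM mxrankM_maxr.
Qed.

Lemma LambdaP (lam mu : 'cV[C]_n) :
  Lambda A lam mu <-> exists c : 'cV[int]_r, mu = lam + ofZ C B *m ofZ C c.
Proof.
have [_ KB] := basisB; rewrite /Lambda KB.
split=> [[_ [c _ <-] <-]|[c ->]]; first by exists c; rewrite ofZM.
by exists (B *m c); [exists c|rewrite ofZM].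
Qed.

Lemma mem_Lambda (lam : 'cV[C]_n) : Lambda A lam lam.
Proof. by apply/LambdaP; exists 0; rewrite ofZ0 mulmx0 addr0. Qed.

Lemma eq_Lambda (lam mu : 'cV[C]_n) :
  Lambda A lam = Lambda A mu <->
  exists c : 'cV[int]_r, lam = mu + ofZ C B *m ofZ C c.
Proof.
split=> [eLa|[c ->]].
  by apply/LambdaP; rewrite -eLa; exact: mem_Lambda.
have sub (a b : 'cV[C]_n) e : a = b + ofZ C B *m ofZ C e ->
    Lambda A a `<=` Lambda A b.
  move=> -> nu /LambdaP[l ->]; apply/LambdaP; exists (e + l).
  by rewrite ofZD mulmxDr addrA.
apply/seteqP; split; first exact: (sub _ _ c).
by apply: (sub _ _ (- c)); rewrite ofZN mulmxN addrK.
Qed.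

(** B has rank r = n - d already because some of its rows have rank r, so its
    columns span the complex kernel of A: both ranks are those over the
    rationals. *)
Lemma kernelP (z : 'cV[C]_n) :
  ofZ C A *m z = 0 <-> exists c : 'cV[C]_r, z = ofZ C B *m c.
Proof.
have AB0 : A *m B = 0.
  have [_ KB] := basisB; apply/matrixP => i j.
  have : KerZ A (B *m delta_mx j 0) by rewrite KB; exists (delta_mx j 0).
  by rewrite /KerZ /= mulmxA -colE => /colP/(_ i); rewrite !mxE.
have ABC0 : ofZ C A *m ofZ C B = 0 by rewrite -ofZM AB0 ofZ0.
split=> [|[c ->]]; last by rewrite mulmxA ABC0 mul0mx.
by apply: mulmx_ker => //; rewrite !rank_ofZ rankA rank_ofZ_basis rE.
Qed.

Lemma exp_lattices_sup_mem (La : set 'cV[C]_n) (lam : 'cV[C]_n) :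
  exp_lattices_sup A beta E La -> La lam ->
  [/\ La = Lambda A lam, ofZ C A *m lam = beta
    & forall j, j \in E -> is_integer (lam j 0)].
Proof.
move=> [[mu mub <-] EmuLa] /LambdaP[c lamE].
have eLa : Lambda A mu = Lambda A lam by apply/esym/eq_Lambda; exists c.
split=> // [|j jE]; last first.
  by apply/(intset_Lambda A); rewrite -eLa; exact: (fintype.subsetP EmuLa).
rewrite lamE mulmxDr mub; have /kernelP -> : exists c',
    ofZ C B *m ofZ C c = ofZ C B *m c' by exists (ofZ C c).
by rewrite addr0.
Qed.

(** A second solution lam differs from lam0 by some B z, and since lam0 is
    integral on E, lam is integral on E exactly when B z is. *)
Lemma exp_lattices_supP (La0 La : set 'cV[C]_n) (lam0 : 'cV[C]_n) :
  exp_lattices_sup A beta E La0 -> La0 lam0 ->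
  exp_lattices_sup A beta E La <->
  exists2 z, z \in Gamma R B E & La = Lambda A (lam0 + ofZ C B *m z).
Proof.
move=> supLa0 /(exp_lattices_sup_mem supLa0)[_ lam0b lam0Z].
split=> [supLa|[z zG ->]].
  have [[lam _ lamE] _] := supLa.
  have La_lam : La lam by rewrite -lamE; exact: mem_Lambda.
  have [-> lamb lamZ] := exp_lattices_sup_mem supLa La_lam.
  have /kernelP[z zE] : ofZ C A *m (lam - lam0) = 0.
    by rewrite mulmxBr lamb lam0b subrr.
  exists z; last by rewrite -zE addrC subrK.
  apply/GammaP => j jE; rewrite -zE.
  have [[k kE] [l lE]] := (lam0Z j jE, lamZ j jE).
  by exists (l - k); rewrite !mxE lE kE mulrzBr.
split.
  exists (lam0 + ofZ C B *m z) => //=; rewrite mulmxDr lam0b.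
  have /kernelP -> : exists c, ofZ C B *m z = ofZ C B *m c by exists z.
  by rewrite addr0.
apply/fintype.subsetP => j jE; apply/intset_Lambda.
have [[k kE] [l lE]] := (lam0Z j jE, (GammaP z).1 zG j jE).
by exists (k + l); rewrite mxE lE kE mulrzDr.
Qed.

Lemma Lambda_bij (La0 : set 'cV[C]_n) (lam0 : 'cV[C]_n) :
  exp_lattices_sup A beta E La0 -> La0 lam0 ->
  exists2 F : GammaModZ R B E -> set 'cV[C]_n,
    (forall z : subgrp (Gamma R B E),
      F (cosetof (int_vec R r) z) = Lambda A (lam0 + ofZ C B *m val z))
    & set_bij [set: GammaModZ R B E] (exp_lattices_sup A beta E) F.
Proof.
move=> supLa0 La0lam0; pose F (q : GammaModZ R B E) :=
  Lambda A (lam0 + ofZ C B *m val (repr q)).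
have Finj (x y : subgrp (Gamma R B E)) :
    cosetof (int_vec R r) x = cosetof (int_vec R r) y <->
    Lambda A (lam0 + ofZ C B *m val x) = Lambda A (lam0 + ofZ C B *m val y).
  rewrite cosetofP eq_Lambda; split=> [/asboolP[c cE]|[c cE]].
    by exists c; rewrite -cE mulmxBr -addrA subrKC.
  apply/asboolP; exists c; apply: (ofZ_mulmx_inj rank_ofZ_basis).
  rewrite mulmxBr; apply/eqP; rewrite subr_eq addrC.
  by rewrite -(inj_eq (addrI lam0)) addrA cE.
have FE x : F (cosetof (int_vec R r) x) = Lambda A (lam0 + ofZ C B *m val x).
  by apply/Finj; rewrite /cosetof reprK.
exists F => //; split=> [q _|p q _ _|La].
- have [x <-] := cosetof_surj q; rewrite FE.
  apply/(exp_lattices_supP _ supLa0 La0lam0).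
  by exists (val x) => //; exact: valP.
- have [[x <-] [y <-]] := (cosetof_surj p, cosetof_surj q).
  by rewrite !FE => /Finj.
- move=> /(exp_lattices_supP _ supLa0 La0lam0)[z zG ->].
  by exists (cosetof _ (Subgrp zG)) => //; rewrite FE.
Qed.

End ExponentLattices.

Lemma set_bij_card_eq T U (A : set T) (B : set U) (f : T -> U) :
  set_bij A B f -> (A #= B)%card.
Proof.
move=> [fAB finj fsurj]; have <- : f @` A = B.
  by apply/seteqP; split=> // _ [x Ax <-]; exact: fAB.
by rewrite card_eq_sym; exact: inj_card_eq.
Qed.

Unset Implicit Arguments.

Theorem proposition4p2 (R : realType) (d n r : nat)
    (A : 'M[int]_(d, n)) (rankA : \rank (ofZ rat A) = d)
    (beta : 'cV[complex R]_d) (rE : r = (n - d)%N)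
    (B : 'M[int]_(n, r)) (basisB : is_Zbasis (KerZ A) B)
    (E : {set 'I_n}) (rankBE : \rank (ofZ rat (rows_in B E)) = r) :
  [/\ (exists2 G : set 'cV[R]_r, full_rank_lattice G &
        [set z : 'cV[complex R]_r | z \in Gamma R B E] = [set complexify x | x in G])
      /\ (forall z : 'cV[complex R]_r, z \in int_vec R r -> z \in Gamma R B E),
      (exists f : {additive GammaModZ R B E -> SatMod B E}, bijective f),
      (forall (La0 : set 'cV[complex R]_n), exp_lattices_sup A beta E La0 ->
        forall lam0 : 'cV[complex R]_n, La0 lam0 ->
        exists2 F : GammaModZ R B E -> set 'cV[complex R]_n,
          (forall z : subgrp (Gamma R B E),
             F (cosetof (int_vec R r) z) = Lambda A (lam0 + ofZ (complex R) B *m val z))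
          & set_bij [set: GammaModZ R B E] (exp_lattices_sup A beta E) F),
      (exp_lattices_sup A beta E !=set0 ->
        (exp_lattices_sup A beta E #= [set: SatMod B E])%card /\
        finite_set [set: SatMod B E])
    & finite_set (exp_lattices_eq A beta E)].
Proof.
have cardsup : exp_lattices_sup A beta E !=set0 ->
    (exp_lattices_sup A beta E #= [set: SatMod B E])%card.
  move=> [La supLa].
  have [lam La_lam] : exists lam, La lam.
    by have [[lam _ <-] _] := supLa; exists lam; exact: mem_Lambda basisB _.
  have [F _ Fbij] := Lambda_bij rankA rE basisB rankBE supLa La_lam.
  have [f fbij] := GammaModZ_iso R rankBE.
  have card1 := set_bij_card_eq Fbij.
  have card2 : ([set: GammaModZ R B E] #= [set: SatMod B E])%card.
    by apply: (@set_bij_card_eq _ _ _ _ f); rewrite setTT_bijective.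
  by apply: card_eq_trans card2; rewrite card_eq_sym.
split.
- by split; [exact: Gamma_full_rank|exact: int_vec_Gamma].
- exact: GammaModZ_iso.
- by move=> La0 supLa0 lam0; exact: Lambda_bij.
- by move=> /cardsup ?; split=> //; exact: finite_SatMod.
- suff finsup : finite_set (exp_lattices_sup (R := R) A beta E).
    by apply: sub_finite_set finsup => La [LaL <-].
  have [->//|/set0P supN0] := eqVneq (exp_lattices_sup (R := R) A beta E) set0.
  by rewrite (eq_finite_set (cardsup supN0)); exact: finite_SatMod.
Qed.
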